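(* Let $f$ be a continuous function on $B_1$ with $0<\nu\le f(x)\le M<\infty$ for all $x\in B_1$, let $u\in C(\overline{B_1})$ be a viscosity solution of $$\min\{f(x)-\Delta_\infty u,\ u\}=0\ \text{ in }B_1,$$ and let $x_0\in\partial\{u>0\}\cap B_1$ be a free boundary point. Then there is a constant $\delta_\star>0$, depending only on the data of the problem (namely on $n$, $\nu$, $M$, $\sup_{B_1}u$ and $\mathrm{dist}(x_0,\partial B_1)$), such that $$\mathscr{L}^n\big(B_\rho(x_0)\cap\{u>0\}\big)\ge\delta_\star\,\rho^n$$ for every $\rho>0$ with $B_\rho(x_0)\subset B_1$.
   Context: $\mathscr{L}^n$ is the Lebesgue measure on $\mathbb{R}^n$, $B_\rho(x)$ is the open ball of radius $\rho$ and center $x$ in $\mathbb{R}^n$, $B_1=B_1(0)$, and $\Delta_\infty u=\sum_{i,j}u_{x_i}u_{x_j}u_{x_ix_j}$. A continuous function $u$ satisfies $\min\{f-\Delta_\infty u,u\}=0$ in $B_1$ in the viscosity sense if $u\ge0$ in $B_1$, $\Delta_\infty u\le f$ in $B_1$, and $\Delta_\infty u\ge f$ in $\{u>0\}$, the last two inequalities in the viscosity sense. Here $\Delta_\infty u\le f$ (resp. $\ge f$) in an open set in the viscosity sense means: whenever $\varphi\in C^2$ touches $u$ from below (resp. from above) at a point $x$ of that set, $\Delta_\infty\varphi(x)\le f(x)$ (resp. $\ge f(x)$). *)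

(* Defs.v *)
From HB Require Import structures.
From mathcomp Require Import all_boot all_order all_algebra.
From mathcomp Require Import all_classical all_reals all_analysis.

Set Implicit Arguments.
Unset Strict Implicit.
Unset Printing Implicit Defensive.

Import Order.TTheory GRing.Theory Num.Theory.
Import numFieldNormedType.Exports.

Local Open Scope classical_set_scope.
Local Open Scope ring_scope.

(* R^n is 'rV[R]_n.  The norm of the library on it is the sup norm; it induces
   the usual topology, so closure, interior, continuity and directional
   derivatives are those of the library, but the Euclidean norm and the
   Euclidean balls have to be defined. *)

Definition enorm (R : realType) (n : nat) (x : 'rV[R]_n) : R :=
  Num.sqrt (\sum_(i < n) x 0 i ^+ 2).

Definition eball (R : realType) (n : nat) (x : 'rV[R]_n) (rho : R) :
    set 'rV[R]_n :=
  [set y | enorm (y - x) < rho].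

Definition unit_ball (R : realType) (n : nat) : set 'rV[R]_n := eball 0 1.

Arguments unit_ball : clear implicits.

Definition bdry (T : topologicalType) (A : set T) : set T :=
  closure A `\` interior A.

Definition edist_to (R : realType) (n : nat) (x : 'rV[R]_n)
    (A : set 'rV[R]_n) : R :=
  inf [set enorm (x - y) | y in A].

Definition box (R : realType) (n : nat) (a b : 'rV[R]_n) : set 'rV[R]_n :=
  [set x | forall i : 'I_n, a 0 i <= x 0 i <= b 0 i].

(* The n-dimensional Lebesgue (outer) measure: infimum of the total volumes of
   the countable covers by boxes.  It is defined on all sets and is the Lebesgue
   measure on the measurable ones.  For n = 0 the boxes are never empty, so this
   is only meant for n > 0. *)
Definition lebesgue_measure_rV (R : realType) (n : nat) (A : set 'rV[R]_n) :
    \bar R :=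
  ereal_inf [set v : \bar R | exists a b : nat -> 'rV[R]_n,
    [/\ forall k (i : 'I_n), a k 0 i <= b k 0 i,
        A `<=` \bigcup_k box (a k) (b k) &
        v = (\sum_(0 <= k <oo) (\prod_(i < n) (b k 0 i - a k 0 i))%:E)%E]].

Definition partial (R : realType) (n : nat) (i : 'I_n) (phi : 'rV[R]_n -> R) :
    'rV[R]_n -> R :=
  fun x => 'D_(delta_mx 0 i) phi x.

(* For V open. *)
Definition C2_on (R : realType) (n : nat) (V : set 'rV[R]_n)
    (phi : 'rV[R]_n -> R) : Prop :=
  forall x, V x ->
  [/\ {for x, continuous phi},
      forall i : 'I_n, derivable phi x (delta_mx 0 i) /\
        {for x, continuous (partial i phi)} &
      forall i j : 'I_n, derivable (partial i phi) x (delta_mx 0 j) /\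
        {for x, continuous (partial j (partial i phi))}].

Definition C2_near (R : realType) (n : nat) (x : 'rV[R]_n)
    (phi : 'rV[R]_n -> R) : Prop :=
  exists V : set 'rV[R]_n, [/\ open V, V x & C2_on V phi].

Definition infty_laplacian (R : realType) (n : nat) (phi : 'rV[R]_n -> R)
    (x : 'rV[R]_n) : R :=
  \sum_(i < n) \sum_(j < n)
    partial i phi x * partial j phi x * partial j (partial i phi) x.

Definition touches_below (R : realType) (n : nat) (phi u : 'rV[R]_n -> R)
    (x : 'rV[R]_n) : Prop :=
  phi x = u x /\ \forall y \near x, phi y <= u y.

Definition touches_above (R : realType) (n : nat) (phi u : 'rV[R]_n -> R)
    (x : 'rV[R]_n) : Prop :=
  phi x = u x /\ \forall y \near x, u y <= phi y.

Definition visc_infty_laplacian_le (R : realType) (n : nat)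
    (U : set 'rV[R]_n) (u f : 'rV[R]_n -> R) : Prop :=
  forall (phi : 'rV[R]_n -> R) (x : 'rV[R]_n),
    U x -> C2_near x phi -> touches_below phi u x ->
    infty_laplacian phi x <= f x.

Definition visc_infty_laplacian_ge (R : realType) (n : nat)
    (U : set 'rV[R]_n) (u f : 'rV[R]_n -> R) : Prop :=
  forall (phi : 'rV[R]_n -> R) (x : 'rV[R]_n),
    U x -> C2_near x phi -> touches_above phi u x ->
    f x <= infty_laplacian phi x.

(* {u > 0}; functions on the closed unit ball are represented by total
   functions whose values outside of it are irrelevant. *)
Definition positivity_set (R : realType) (n : nat) (u : 'rV[R]_n -> R) :
    set 'rV[R]_n :=
  [set x | unit_ball R n x /\ 0 < u x].

Definition obstacle_solution (R : realType) (n : nat)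
    (f u : 'rV[R]_n -> R) : Prop :=
  [/\ forall x, unit_ball R n x -> 0 <= u x,
      visc_infty_laplacian_le (unit_ball R n) u f &
      visc_infty_laplacian_ge (positivity_set u) u f].

(* Main.v *)
(* If u > h at the centre of a ball B_R(y), where h is comparable to R^(4/3),
   then u > 0 on B_R(y): otherwise u would be touched from below, away from y,
   by a radial barrier vanishing on the boundary of the ball whose infinity
   Laplacian exceeds M.  Near a free boundary point, sliding the paraboloid
   a |x - y1|^2, whose infinity Laplacian 8 a^3 |x - y1|^2 stays below nu, gives
   nondegeneracy: within distance rho / 2 of x0 there is y with
   u(y) >= c rho^(4/3).  Hence u > 0 on a ball B_(k rho)(y) contained in
   B_rho(x0). *)
Require Import Defs.
From mathcomp Require Import all_boot all_order all_algebra.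
From mathcomp Require Import all_classical all_reals all_analysis.
From mathcomp Require Import measurable_realfun ring lra.
Import Order.TTheory GRing.Theory Num.Theory.
Import numFieldNormedType.Exports.
Local Open Scope classical_set_scope.
Local Open Scope ring_scope.

(** * The Euclidean norm and compactness of closed Euclidean balls *)

Section EuclideanNorm.
Context {R : realType} {n : nat}.
Implicit Types x y z : 'rV[R]_n.

Lemma enorm_ge0 x : 0 <= enorm x.
Proof. exact: sqrtr_ge0. Qed.

Lemma sqr_enorm x : enorm x ^+ 2 = \sum_(i < n) x 0 i ^+ 2.
Proof. by rewrite sqr_sqrtr// sumr_ge0// => i _; exact: sqr_ge0. Qed.

Lemma enorm0 : enorm (0 : 'rV[R]_n) = 0.
Proof.
by apply/eqP; rewrite -sqrf_eq0 sqr_enorm big1// => i _; rewrite mxE expr0n.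
Qed.

Lemma coord_le_enorm x i : `|x 0 i| <= enorm x.
Proof.
rewrite -(ler_pXn2r (ltn0Sn 1)) ?nnegrE ?enorm_ge0// sqr_enorm (bigD1 i)//=.
by rewrite real_normK ?num_real// lerDl sumr_ge0// => j _; exact: sqr_ge0.
Qed.

Lemma enorm_eq0 x : enorm x = 0 -> x = 0.
Proof.
move=> x0; apply/rowP => i; have := coord_le_enorm x i.
by rewrite x0 normr_le0 mxE => /eqP.
Qed.

(** Cauchy-Schwarz: sum the squares of [enorm y * x 0 i - enorm x * y 0 i] over the coordinates and
    divide by [enorm x * enorm y]; when this product vanishes, one of the vectors is zero. *)
Lemma dot_le_enorm x y : \sum_(i < n) x 0 i * y 0 i <= enorm x * enorm y.
Proof.
have [/eqP|p0] := eqVneq (enorm x * enorm y) 0.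
  rewrite mulf_eq0 => xy0; rewrite big1 ?mulr_ge0 ?enorm_ge0// => i _.
  have := coord_le_enorm x i; have := coord_le_enorm y i.
  by case/orP: xy0 => /eqP ->; rewrite normr_le0 => /eqP y0;
    rewrite ?normr_le0 => H; try move/eqP: H => H; rewrite ?y0 ?H ?mulr0 ?mul0r.
have pq : 0 < enorm x * enorm y by rewrite lt_def p0 mulr_ge0 ?enorm_ge0.
have : \sum_(i < n) 2 * (enorm x * enorm y) * (x 0 i * y 0 i) <=
       \sum_(i < n) (enorm y ^+ 2 * x 0 i ^+ 2 + enorm x ^+ 2 * y 0 i ^+ 2).
  apply: ler_sum => i _.
  by have := sqr_ge0 (enorm y * x 0 i - enorm x * y 0 i); lra.
rewrite big_split/= -!mulr_sumr -!sqr_enorm => H.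
rewrite -(ler_pM2l pq); lra.
Qed.

Lemma enormD x y : enorm (x + y) <= enorm x + enorm y.
Proof.
rewrite -(ler_pXn2r (ltn0Sn 1)) ?nnegrE ?addr_ge0 ?enorm_ge0//.
rewrite sqr_enorm (eq_bigr (fun i => x 0 i ^+ 2 + 2 * (x 0 i * y 0 i)
    + y 0 i ^+ 2)); last by move=> i _; rewrite mxE; ring.
rewrite !big_split/= -mulr_sumr -!sqr_enorm.
by have := dot_le_enorm x y; lra.
Qed.

Lemma enorm_trans y x z : enorm (x - z) <= enorm (x - y) + enorm (y - z).
Proof. by have := enormD (x - y) (y - z); rewrite addrA subrK. Qed.

Lemma coordB_continuous y i : continuous (fun x => x 0 i - y 0 i).
Proof.
move=> x; apply: continuousB; [exact: coord_continuous | exact: cst_continuous].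
Qed.

Lemma sqr_enormB_continuous y : continuous (fun x => enorm (x - y) ^+ 2).
Proof.
rewrite (_ : (fun x => _) = fun x => \sum_(i < n) (x 0 i - y 0 i) * (x 0 i - y 0 i)).
  apply: (@continuous_big R _ +%R 0 xpredT _ _ _
    (fun i (x : 'rV[R]_n) => (x 0 i - y 0 i) * (x 0 i - y 0 i))) => [|i _ x].
    by move=> z; exact: add_continuous.
  have H := coordB_continuous y i x; exact: (continuousM H H).
apply/funext => x; rewrite sqr_enorm.
by apply: eq_bigr => i _; rewrite !mxE expr2.
Qed.

Lemma enormB_continuous y : continuous (fun x => enorm (x - y)).
Proof.
rewrite (_ : (fun x => _) = Num.sqrt \o fun x => enorm (x - y) ^+ 2).
  move=> x; have H := sqr_enormB_continuous y x.
  exact: (continuous_comp H (@sqrt_continuous R _)).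
by apply/funext => x /=; rewrite sqrtr_sqr ger0_norm ?enorm_ge0.
Qed.

Lemma eball_nbhs x y r : enorm (x - y) < r ->
  \forall z \near x, enorm (z - y) < r.
Proof.
by have H := enormB_continuous y x; exact: (cvgr_lt _ H).
Qed.

Definition ecball x r : set 'rV[R]_n := [set y | enorm (y - x) <= r].

Lemma ecball_compact x r : compact (ecball x r).
Proof.
apply: bounded_closed_compact.
- exists (r + `|x|); split; first exact: num_real.
  move=> M Mr y xyr; apply/(le_trans _ (ltW Mr)).
  rewrite -[y](subrK x) (le_trans (ler_normD _ _))// lerD2r.
  rewrite [leLHS]/Num.norm/= mx_normrE; apply: bigmax_le => //=.
    (* The maximum defining the sup norm starts from 0, so [0 <= r] is also required; it follows
       from the ball containing [y]. *)
    exact: le_trans (enorm_ge0 _) xyr.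
  move=> [i j] _ /=; rewrite ord1.
  exact: le_trans (coord_le_enorm _ _) xyr.
- rewrite (_ : ecball x r = (fun y => enorm (y - x)) @^-1` [set t | t <= r])//.
  apply: closed_comp; last exact: closed_le.
  by move=> y _; exact: enormB_continuous.
Qed.

End EuclideanNorm.

(** * Radial quartic test functions and their infinity Laplacian *)

Section RadialQuartic.
Context {R : realType} {n : nat}.
Variables (y : 'rV[R]_n) (c b g : R).
Implicit Types x : 'rV[R]_n.

(** One family provides both test functions: the paraboloid for [g = 0], and the smooth substitute
    for a cone otherwise. Even powers of the norm keep it polynomial, hence C2 also at [y]. *)
Definition radial_quartic x : R :=
  c + b * enorm (x - y) ^+ 2 + g * enorm (x - y) ^+ 4.

Let sq x : R := enorm (x - y) ^+ 2.
Let coord (i : 'I_n) x : R := x 0 i - y 0 i.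

Let is_derive_coord i j x :
  is_derive x (delta_mx 0 j) (coord i) (i == j)%:R.
Proof.
have dc : is_derive x (delta_mx 0 j) (fun N : 'rV[R]_n => N 0 i : R) (i == j)%:R.
  apply: DeriveDef; first exact/diff_derivable/differentiable_coord.
  apply: cvg_lim => //=; rewrite /shift/=.
  apply: cvg_near_cst; near=> h; rewrite !mxE eqxx/= addrK /GRing.scale/=.
  rewrite mulKf//; near: h; exact: nbhs_dnbhs_neq.
apply: (is_derive_eq (@is_deriveB _ _ _ _ (cst (y 0 i)) _ _ _ _ dc _)).
by rewrite subr0.
Unshelve. all: by end_near. Qed.

Let sqE : sq = \sum_(i < n) coord i * coord i.
Proof.
apply/funext => x; rewrite /sq sqr_enorm fct_sumE; apply: eq_bigr => i _.
by rewrite !mxE expr2.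
Qed.

Let is_derive_sq j x : is_derive x (delta_mx 0 j) sq (2 * coord j x).
Proof.
rewrite sqE; apply: is_derive_eq.
  by apply: is_derive_sum => i; apply: is_deriveM; exact: is_derive_coord.
rewrite (bigD1 j)//= eqxx big1 => [|i /negbTE ->]; rewrite /GRing.scale/=; ring.
Qed.

Let radial_quarticE :
  radial_quartic = cst c + cst b * sq + cst g * (sq * sq).
Proof.
apply/funext => x; rewrite /radial_quartic /sq /= !fctE; ring.
Qed.

Let is_derive_radial_quartic j x :
  is_derive x (delta_mx 0 j) radial_quartic ((b + 2 * g * sq x) * (2 * coord j x)).
Proof.
have ds := is_derive_sq j x; rewrite radial_quarticE.
apply: (is_derive_eq (is_deriveD (is_deriveD (is_derive_cst c x _)
  (is_deriveM (is_derive_cst b x _) ds))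
  (is_deriveM (is_derive_cst g x _) (is_deriveM ds ds)))).
rewrite /GRing.scale/= !fctE /cst; ring.
Qed.

Let partial_radial_quartic j :
  partial j radial_quartic = (cst b + cst (2 * g) * sq) * (cst 2 * coord j).
Proof.
apply/funext => x; rewrite /partial.
by have := is_derive_radial_quartic j x => h; rewrite derive_val !fctE /cst.
Qed.

Let is_derive_partial_radial_quartic i j x :
  is_derive x (delta_mx 0 j) (partial i radial_quartic)
    (2 * (b + 2 * g * sq x) * (i == j)%:R + 8 * g * (coord i x * coord j x)).
Proof.
have ds := is_derive_sq j x; have dc := is_derive_coord i j x.
rewrite partial_radial_quartic.
apply: (is_derive_eq (is_deriveM (is_deriveD (is_derive_cst b x _)
  (is_deriveM (is_derive_cst (2 * g) x _) ds))
  (is_deriveM (is_derive_cst (2 : R) x _) dc))).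
rewrite /GRing.scale/= !fctE /cst; ring.
Qed.

Let partial2_radial_quartic i j :
  partial j (partial i radial_quartic) =
    cst 2 * (cst b + cst (2 * g) * sq) * cst (i == j)%:R
      + cst (8 * g) * (coord i * coord j).
Proof.
apply/funext => x; rewrite {1}/partial.
by have := is_derive_partial_radial_quartic i j x => h;
  rewrite derive_val !fctE /cst.
Qed.

Let sq_continuous : continuous sq.
Proof. exact: sqr_enormB_continuous. Qed.

Let coord_continuous i : continuous (coord i).
Proof. exact: coordB_continuous. Qed.

Let continuous_cst (r : R) x : {for x, continuous (cst r : 'rV[R]_n -> R)}.
Proof. exact: cst_continuous. Qed.

Let continuousDr {p q : 'rV[R]_n -> R} {x} :
  {for x, continuous p} -> {for x, continuous q} -> {for x, continuous (p + q)}.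
Proof. exact: continuousD. Qed.

Let continuousMr {p q : 'rV[R]_n -> R} {x} :
  {for x, continuous p} -> {for x, continuous q} -> {for x, continuous (p * q)}.
Proof. exact: continuousM. Qed.

Let radial_quartic_continuous : continuous radial_quartic.
Proof.
move=> x; rewrite radial_quarticE; have cs := @sq_continuous x.
exact: (continuousDr (continuousDr (continuous_cst c x)
  (continuousMr (continuous_cst b x) cs))
  (continuousMr (continuous_cst g x) (continuousMr cs cs))).
Qed.

Lemma C2_radial_quartic x : C2_near x radial_quartic.
Proof.
exists setT; split => //; first exact: openT.
move=> z _; have cs := @sq_continuous z; have cc i := @coord_continuous i z.
split; first exact: radial_quartic_continuous.
- move=> i; split; first by have [] := is_derive_radial_quartic i z.
  rewrite partial_radial_quartic.
  exact: (continuousMr (continuousDr (continuous_cst b z)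
    (continuousMr (continuous_cst (2 * g) z) cs))
    (continuousMr (continuous_cst 2 z) (cc i))).
- move=> i j; split; first by have [] := is_derive_partial_radial_quartic i j z.
  rewrite partial2_radial_quartic.
  exact: (continuousDr (continuousMr (continuousMr (continuous_cst 2 z)
    (continuousDr (continuous_cst b z) (continuousMr (continuous_cst (2 * g) z) cs)))
    (continuous_cst _ z)) (continuousMr (continuous_cst (8 * g) z)
    (continuousMr (cc i) (cc j)))).
Qed.

(** For a radial profile [p] of [q = enorm (x - y)] the infinity Laplacian is [p'(q)^2 p''(q)]; here
    [p' = 2 q (b + 2 g q^2)] and [p'' = 2 (b + 6 g q^2)]. *)
Lemma infty_laplacian_radial_quartic x :
  infty_laplacian radial_quartic x =
  8 * (b + 2 * g * enorm (x - y) ^+ 2) ^+ 2 * enorm (x - y) ^+ 2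
    * (b + 6 * g * enorm (x - y) ^+ 2).
Proof.
rewrite /infty_laplacian -/(sq x); set G := b + 2 * g * sq x.
have sx : sq x = \sum_(i < n) coord i x ^+ 2.
  by rewrite sqE fct_sumE; apply: eq_bigr => i _; rewrite expr2.
transitivity (\sum_(i < n) (8 * G ^+ 3 * coord i x ^+ 2
    + 32 * G ^+ 2 * g * sq x * coord i x ^+ 2)).
  apply: eq_bigr => i _.
  (* The Hessian is [2 G] times the identity plus a rank-one matrix; the first part only contributes
     for [j = i], the second sums to a multiple of [sq x]. *)
  rewrite (eq_bigr (fun j => 8 * G ^+ 3 * coord i x * coord j x * (i == j)%:R
    + 32 * G ^+ 2 * g * coord i x ^+ 2 * coord j x ^+ 2)); last first.
    move=> j _; rewrite partial2_radial_quartic !partial_radial_quartic.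
    rewrite !fctE /cst -/G; ring.
  rewrite big_split/= -mulr_sumr -sx; congr (_ + _); last by ring.
  rewrite (bigD1 i)//= eqxx big1 ?addr0 ?mulr1; first by ring.
  by move=> j; rewrite eq_sym => /negbTE ->; rewrite mulr0.
rewrite big_split/= -!mulr_sumr -sx /G; ring.
Qed.

End RadialQuartic.

(** * A lower bound for the outer measure of a set containing a box *)

Section BoxVolume.
Context {R : realType}.

(** Points are sequences of which only the first [n] terms count, so that the dimension can vary in
    an induction without casts. *)
Definition box_indic (n : nat) (a b x : nat -> R) : R :=
  \prod_(i < n) \1_`[a i, b i] (x i).

(* The weights [c] make the induction on the dimension work: integrating out the
   last coordinate turns them into [c k * \1_`[ak k n, bk k n] t]. *)
Lemma weighted_cover_volume n (a b : nat -> R) (ak bk : nat -> nat -> R)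
    (c : nat -> R) :
  (forall i, a i <= b i) -> (forall k i, ak k i <= bk k i) ->
  (forall k, 0 <= c k) ->
  (forall x, (forall i, a i <= x i <= b i) ->
    (1 <= \sum_(0 <= k <oo) (c k * box_indic n (ak k) (bk k) x)%:E)%E) ->
  ((\prod_(i < n) (b i - a i))%:E <=
     \sum_(0 <= k <oo) (c k * \prod_(i < n) (bk k i - ak k i))%:E)%E.
Proof.
move=> ab akbk; elim: n c => [|n IHn] c c0 cov.
  rewrite big_ord0; apply: le_trans (cov a _) _ => [i|]; first by rewrite lexx ab.
  apply: lee_nneseries => [k _ _|k _]; rewrite /box_indic !big_ord0//.
  by rewrite lee_fin mulr1.
pose v := \prod_(i < n) (b i - a i).
pose vk k := \prod_(i < n) (bk k i - ak k i).
have vk0 k : 0 <= vk k by apply: prodr_ge0 => i _; rewrite subr_ge0.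
have indic0 k t : 0 <= \1_`[ak k n, bk k n] t :> R by rewrite indicE.
have slice t : a n <= t <= b n ->
    (v%:E <= \sum_(0 <= k <oo) (c k * \1_`[ak k n, bk k n] t * vk k)%:E)%E.
  move=> tab; apply: IHn => [k|x xab]; first by rewrite mulr_ge0.
  have := cov (fun i => if i == n then t else x i).
  have H i : a i <= (if i == n then t else x i) <= b i.
    by have [->|] := eqVneq i n.
  move=> /(_ H) /le_trans; apply; apply: lee_nneseries => [k _ _|k _].
    rewrite lee_fin mulr_ge0 ?mulr_ge0// /box_indic prodr_ge0// => i _.
  rewrite lee_fin /box_indic big_ord_recr/= eqxx.
  rewrite mulrAC -mulrA le_eqVlt; apply/orP; left; apply/eqP.
  congr (_ * (_ * _)); apply: eq_bigr => i _.
  by rewrite (ltn_eqF (ltn_ord i)).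
rewrite big_ord_recr/= -/v.
(* The last edge length becomes an integral, so that [slice] can be integrated in [t]; nonnegativity
   of the terms then allows exchanging sum and integral. *)
have -> : (v * (b n - a n))%:E =
    (\int[lebesgue_measure]_(t in `[a n, b n]) v%:E)%E.
  rewrite integral_cst//= lebesgue_measure_itv/= lte_fin EFinM.
  have := ab n; rewrite le_eqVlt => /orP[/eqP ->|->]; last by rewrite EFinB.
  by rewrite ltxx subrr.
apply: (@le_trans _ _ (\int[lebesgue_measure]_(t in `[a n, b n])
  \sum_(0 <= k <oo) (c k * \1_`[ak k n, bk k n] t * vk k)%:E)%E).
  apply: ge0_le_integral => //.
  - by move=> t _; rewrite lee_fin prodr_ge0// => i _; rewrite subr_ge0.
  - apply: ge0_emeasurable_sum => [k t _ _|k _].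
      by rewrite lee_fin mulr_ge0// mulr_ge0.
    apply/measurable_EFinP; apply: measurable_funM => //.
    by apply: measurable_funM => //.
rewrite integral_nneseries//; last 2 first.
  - move=> k; apply/measurable_EFinP; apply: measurable_funM => //.
    by apply: measurable_funM => //.
  - by move=> k t _; rewrite lee_fin mulr_ge0// mulr_ge0.
apply: lee_nneseries => [k _ _|k _].
  by apply: integral_ge0 => t _; rewrite lee_fin mulr_ge0// mulr_ge0.
under eq_integral do rewrite mulrAC EFinM.
rewrite ge0_integralZl_EFin//; last 2 first.
  - by apply/measurable_EFinP.
  - by rewrite mulr_ge0.
rewrite integral_indic// big_ord_recr/= mulrA [leRHS]EFinM.
apply: lee_wpmul2l; first by rewrite lee_fin mulr_ge0.
(* The integral only sees the part of the covering edge inside [[a n, b n]], which is at most the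
   whole edge. *)
apply: (@le_trans _ _ (lebesgue_measure (`[ak k n, bk k n]%classic : set R))).
  by apply: le_measure; rewrite ?inE//; exact: measurableI.
rewrite lebesgue_measure_itv/= lte_fin -EFinB; case: ifP => // _.
by rewrite lee_fin subr_ge0.
Qed.

(** A cover of [A] covers the box, so the indicators of its members sum to at least 1 there: the
    weighted estimate applies with all weights 1. *)
Lemma box_volume_le n (a b : 'rV[R]_n) (A : set 'rV[R]_n) :
  (forall i, a 0 i <= b 0 i) -> box a b `<=` A ->
  ((\prod_(i < n) (b 0 i - a 0 i))%:E <= lebesgue_measure_rV A)%E.
Proof.
move=> ab abA; apply/ereal_infP => _ [ak [bk [akbk Acov ->]]].
(* Rows are extended to sequences by 0; lower and upper corners then agree beyond [n], so the edges
   stay ordered there. *)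
pose e (w : 'rV[R]_n) (i : nat) : R := if insub i is Some j then w 0 j else 0.
have eE w (i : 'I_n) : e w i = w 0 i by rewrite /e valK.
have e_le (w w' : 'rV[R]_n) : (forall i, w 0 i <= w' 0 i) -> forall i, e w i <= e w' i.
  by move=> ww' i; rewrite /e; case: insub.
have prodE (w w' : 'rV[R]_n) : \prod_(i < n) (w 0 i - w' 0 i) = \prod_(i < n) (e w i - e w' i).
  by apply: eq_bigr => i _; rewrite !eE.
rewrite prodE (eq_eseriesr (g := fun k =>
  (1 * \prod_(i < n) (e (bk k) i - e (ak k) i))%:E)); last first.
  by move=> k _; rewrite prodE mul1r.
apply: (@weighted_cover_volume n (e a) (e b) (fun k => e (ak k))
  (fun k => e (bk k)) (fun=> 1)) => //; [exact: e_le|by move=> k; exact: e_le|].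
move=> x xab; pose p : 'rV[R]_n := \row_i x i.
have /abA/Acov[k _ pk] : box a b p by move=> i; rewrite mxE -!eE.
have ge0 k' : (0 <= (1 * box_indic n (e (ak k')) (e (bk k')) x)%:E)%E.
  by rewrite lee_fin mul1r /box_indic prodr_ge0// => i _; rewrite indicE.
have <- : (1 * box_indic n (e (ak k)) (e (bk k)) x)%:E = 1%E.
  rewrite mul1r /box_indic big1// => i _; rewrite indicE mem_set//= in_itv/= !eE.
  by have := pk i; rewrite mxE.
rewrite (@nneseriesD1 _ _ k xpredT) => [|j _|]; [|exact: ge0|by []].
by rewrite leeDl// nneseries_ge0// => j _ _; exact: ge0.
Qed.

End BoxVolume.

(** * Continuity of comparison functions and an elementary inequality *)

Lemma within_continuousB {R : realType} {T : topologicalType} (A : set T)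
    (p q : T -> R) : {within A, continuous p} -> continuous q ->
  {within A, continuous (fun x => p x - q x)}.
Proof.
move=> cp cq x; have cqx : {within A, continuous q} by exact: continuous_subspaceT.
exact: (continuousB (cp x) (cqx x)).
Qed.

Lemma continuous_mull {R : realType} {T : topologicalType} (c : R) {p : T -> R} :
  continuous p -> continuous (fun x => c * p x).
Proof.
move=> cp x; have cc : {for x, continuous (fun=> c : R)} by exact: cst_continuous.
exact: (continuousM cc (cp x)).
Qed.

(* With [t] the contact radius, this is what makes the quartic replacing the
   cone in [positivity_propagation] lie below it at the radii [q] near [t]. *)
Lemma contact_bound {R : realFieldType} (r t q : R) :
  0 < t -> t < r -> 0 <= q -> q < t + t ^+ 2 / (6 * r) ->
  (3 * r - t) / (24 * r * t ^+ 3) * (q + t) ^+ 2 <= (2 * t)^-1.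
Proof.
move=> t0 tr q0 qt; have r0 : 0 < r by lra.
have rn0 : r != 0 by rewrite gt_eqF.
have tn0 : t != 0 by rewrite gt_eqF.
have k0 : 0 < (3 * r - t) / (24 * r * t ^+ 3).
  by rewrite divr_gt0 ?mulr_gt0 ?exprn_gt0//; lra.
apply: (@le_trans _ _ ((3 * r - t) / (24 * r * t ^+ 3)
    * (2 * t + t ^+ 2 / (6 * r)) ^+ 2)).
  by rewrite ler_pM2l// ler_pXn2r// ?nnegrE; lra.
(* In this scale-free variable the claim is [(1 - 2 v) (2 + v)^2 <= 4], and the left side expands to
   [4 - 4 v - 7 v^2 - 2 v^3]. *)
pose v := t / (6 * r).
have v0 : 0 < v by rewrite divr_gt0 ?mulr_gt0.
have -> : (3 * r - t) / (24 * r * t ^+ 3) * (2 * t + t ^+ 2 / (6 * r)) ^+ 2 =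
    (1 - 2 * v) * (2 + v) ^+ 2 / 8 / t.
  by rewrite /v; field; rewrite rn0 tn0.
rewrite invfM ler_pM2r ?invr_gt0//.
have v2 : 0 < v ^+ 2 by rewrite exprn_gt0.
have v3 : 0 < v ^+ 3 by rewrite exprn_gt0.
clearbody v; lra.
Qed.

(** * Nondegeneracy, propagation of positivity, and the volume of a ball *)

Section ObstacleProblem.
Context {R : realType} {n : nat}.
Implicit Types (x y z : 'rV[R]_n) (f u : 'rV[R]_n -> R).

(** A maximum point of [u - a |x - y|^2] over the closed ball must lie on the sphere, since at an
    interior one the paraboloid would touch [u] from above. Comparison with the centre, where [u] is
    positive, gives the strict bound. *)
Lemma nondegeneracy f u y (nu a r : R) :
  0 < a -> 0 < r -> 8 * a ^+ 3 * r ^+ 2 < nu ->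
  ecball y r `<=` unit_ball R n ->
  (forall x, unit_ball R n x -> nu <= f x) ->
  {within ecball y r, continuous u} ->
  visc_infty_laplacian_ge (positivity_set u) u f ->
  0 < u y ->
  exists2 x, enorm (x - y) = r & a * r ^+ 2 < u x.
Proof.
move=> a0 r0 anu yrU nuf ucont uge uy0.
have cpsi : {within ecball y r, continuous (fun x => u x - a * enorm (x - y) ^+ 2)}.
  by apply: within_continuousB => //; exact/continuous_mull/sqr_enormB_continuous.
have yy : ecball y r y by rewrite /ecball/= subrr enorm0 ltW.
have [x /set_mem xr xmax] := EVT_max_rV (ex_intro _ y yy) (ecball_compact y r) cpsi.
have {}xmax z : ecball y r z ->
    u z - a * enorm (z - y) ^+ 2 <= u x - a * enorm (x - y) ^+ 2.
  by move=> zr; apply: xmax; exact: mem_set.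
have ux : a * enorm (x - y) ^+ 2 < u x.
  have := xmax _ yy; rewrite subrr enorm0; lra.
(* The lower bound on the infinity Laplacian is available only where [u] is positive. *)
have ux0 : 0 < u x.
  by apply: le_lt_trans ux; rewrite mulr_ge0 ?sqr_ge0// ltW.
move: (xr); rewrite /ecball/= le_eqVlt => /orP[/eqP xyr|xyr].
  by exists x => //; rewrite -xyr.
exfalso.
pose c := u x - a * enorm (x - y) ^+ 2.
have := uge (radial_quartic y c a 0) x (conj (yrU _ xr) ux0)
  (C2_radial_quartic y c a 0 x).
rewrite infty_laplacian_radial_quartic => H.
have {H}/H : touches_above (radial_quartic y c a 0) u x.
  split; first by rewrite /radial_quartic /c; ring.
  near=> z; have zr : ecball y r z.
    by rewrite /ecball/= ltW//; near: z; exact: eball_nbhs.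
  by have := xmax _ zr; rewrite /radial_quartic /c; lra.
have := nuf _ (yrU _ xr).
have : 8 * a ^+ 3 * enorm (x - y) ^+ 2 <= 8 * a ^+ 3 * r ^+ 2.
  rewrite ler_pM2l ?mulr_gt0 ?exprn_gt0//.
  by rewrite ler_pXn2r// ?nnegrE ?enorm_ge0// ltW.
rewrite mulr0 mul0r mulr0 mul0r !addr0; lra.
Unshelve. all: by end_near. Qed.

(* The conical barrier [w x = A (r - q) ^+ 2 + A r (r - q)], [q = enorm (x - y)],
   is not differentiated directly: at the contact point it is replaced by a
   quartic touching it from below, whose infinity Laplacian still exceeds [M]. *)
Lemma positivity_propagation f u y (M A r : R) :
  0 < A -> 0 < r -> M < A ^+ 3 * r ^+ 2 ->
  ecball y r `<=` unit_ball R n ->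
  (forall x, unit_ball R n x -> f x <= M) ->
  (forall x, unit_ball R n x -> 0 <= u x) ->
  {within ecball y r, continuous u} ->
  visc_infty_laplacian_le (unit_ball R n) u f ->
  2 * A * r ^+ 2 <= u y ->
  forall x, enorm (x - y) < r -> 0 < u x.
Proof.
move=> A0 r0 MA yrU fM u0 ucont ule uy.
pose w x := A * enorm (x - y) ^+ 2 - 3 * A * r * enorm (x - y) + 2 * A * r ^+ 2.
have wE x : w x = A * (r - enorm (x - y)) * (2 * r - enorm (x - y)).
  by rewrite /w; ring.
have cpsi : {within ecball y r, continuous (fun x => u x - w x)}.
  apply: within_continuousB => // x.
  have cq2 := continuous_mull A (sqr_enormB_continuous y) x.
  have cq := continuous_mull (3 * A * r) (enormB_continuous y) x.
  have cc : {for x, continuous (fun=> 2 * A * r ^+ 2)} by exact: cst_continuous.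
  exact: (continuousD (continuousB cq2 cq) cc).
have yy : ecball y r y by rewrite /ecball/= subrr enorm0 ltW.
have [c /set_mem cr cmin] := EVT_min_rV (ex_intro _ y yy) (ecball_compact y r) cpsi.
have {}cmin z : ecball y r z -> u c - w c <= u z - w z.
  by move=> zr; apply: cmin; exact: mem_set.
suff uwc : 0 <= u c - w c.
  move=> x xr; have := cmin x (ltW xr).
  have : 0 < w x by rewrite wE !mulr_gt0//; lra.
  lra.
rewrite leNgt; apply/negP => uwc.
set t := enorm (c - y) in cr uwc *.
(* Contact is impossible at the centre, where [w = 2 A r^2 <= u], and on the sphere, where
   [w = 0 <= u]. *)
have t0 : 0 < t.
  rewrite lt_def enorm_ge0 andbT; apply/negP => /eqP t0.
  have cy : c = y by apply/eqP; rewrite -subr_eq0 (@enorm_eq0 _ _ (c - y) t0).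
  by move: uwc; rewrite /w cy subrr enorm0; lra.
have tr : t < r.
  rewrite lt_neqAle cr andbT; apply/eqP => tr.
  have := u0 _ (yrU _ cr); move: uwc; rewrite wE -/t tr subrr mulr0 mul0r; lra.
(* The quartic is to be [w + (u c - w c) - D (q - t)^2 (h - k (q + t)^2)], with [q = enorm (z - y)].
   The choice of [h] cancels the odd term [- D q] of [w]; that of [k] leaves the second radial
   derivative [A] at [t], half that of [w], while the first is unchanged. *)
pose k := (3 * r - t) / (24 * r * t ^+ 3).
pose D := 3 * A * r.
pose h := (2 * t)^-1.
pose b := A - D * h - 2 * D * k * t ^+ 2.
pose g := D * k.
pose e := 2 * A * r ^+ 2 - D * (h * t ^+ 2 - k * t ^+ 4) + (u c - w c).
have k0 : 0 < k by rewrite divr_gt0 ?mulr_gt0 ?exprn_gt0//; lra.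
have rn0 : r != 0 by rewrite gt_eqF.
have tn0 : t != 0 by rewrite gt_eqF.
have h0 : 0 < h by rewrite invr_gt0 mulr_gt0.
have kh q : 0 <= q -> q < t + t ^+ 2 / (6 * r) -> k * (q + t) ^+ 2 <= h.
  exact: contact_bound.
have := ule (radial_quartic y e b g) c (yrU _ cr) (C2_radial_quartic y e b g c).
have ht : 2 * h * t = 1 by rewrite mulrAC mulfV// mulf_neq0.
have Dk : 4 * (D * k) * t ^+ 2 = D * h - A / 2.
  by rewrite /h /D /k; field; rewrite ?rn0 ?tn0.
have radialE z : radial_quartic y e b g z = w z + (u c - w c) -
    D * ((enorm (z - y) - t) ^+ 2 * (h - k * (enorm (z - y) + t) ^+ 2)).
  rewrite /radial_quartic /e /b /g.
  have -> : w z = A * enorm (z - y) ^+ 2 - D * enorm (z - y) * (2 * h * t)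
    + 2 * A * r ^+ 2 by rewrite ht mulr1.
  clearbody h k; move: (enorm (z - y)) (w c) => q wc; ring.
have -> : infty_laplacian (radial_quartic y e b g) c =
    4 * A ^+ 3 * (3 * r / 2 - t) ^+ 2.
  rewrite infty_laplacian_radial_quartic -/t.
  have -> : b + 6 * g * t ^+ 2 = A / 2.
    transitivity (A - D * h + 4 * (D * k) * t ^+ 2); last by rewrite Dk; field.
    by rewrite /b /g; ring.
  have -> : b + 2 * g * t ^+ 2 = A - D * h by rewrite /b /g; ring.
  transitivity (4 * A * (A * t - D * (2 * h * t) / 2) ^+ 2); first by field.
  by rewrite ht mulr1 /D; field.
move=> H; have {H}/H : touches_below (radial_quartic y e b g) u c.
  split; first by rewrite radialE -/t; ring.
  near=> z.
  have zr : ecball y r z.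
    by rewrite /ecball/= ltW//; near: z; exact: eball_nbhs.
  rewrite radialE; have := cmin _ zr.
  suff : 0 <= D * ((enorm (z - y) - t) ^+ 2 * (h - k * (enorm (z - y) + t) ^+ 2)).
    by lra.
  apply: mulr_ge0; first by rewrite !mulr_ge0 ?ltW.
  (* The quartic is compared with [w] only for [q < t + t^2 / (6 r)], a neighbourhood of the contact
     point. *)
  rewrite mulr_ge0 ?sqr_ge0// subr_ge0 kh ?enorm_ge0//.
  near: z; apply: eball_nbhs.
  by rewrite -/t ltrDl divr_gt0 ?exprn_gt0 ?mulr_gt0.
(* Since [t < r], the factor [3 r / 2 - t] exceeds [r / 2]. *)
have : A ^+ 3 * r ^+ 2 <= 4 * A ^+ 3 * (3 * r / 2 - t) ^+ 2.
  rewrite -mulrA (mulrCA 4) ler_pM2l ?exprn_gt0//; nra.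
have := fM _ (yrU _ cr); lra.
Unshelve. all: by end_near. Qed.

(** The concentric cube of edge [r / n] fits in the ball: its half-diagonal is [r / (2 sqrt n)]. *)
Lemma eball_volume_le y (r : R) (A : set 'rV[R]_n) : (0 < n)%N -> 0 < r ->
  eball y r `<=` A ->
  (((r / n%:R) ^+ n)%:E <= lebesgue_measure_rV A)%E.
Proof.
move=> n0 r0 yrA; have n0' : 0 < n%:R :> R by rewrite ltr0n.
pose l := r / n%:R / 2.
have l0 : 0 < l by rewrite !divr_gt0.
pose a : 'rV[R]_n := \row_i (y 0 i - l).
pose b : 'rV[R]_n := \row_i (y 0 i + l).
have -> : (r / n%:R) ^+ n = \prod_(i < n) (b 0 i - a 0 i).
  rewrite (eq_bigr (fun=> r / n%:R)) ?prodr_const ?card_ord//.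
  by move=> i _; rewrite !mxE /l; field; rewrite gt_eqF.
apply: box_volume_le => [i|x xab]; first by rewrite !mxE; lra.
apply: yrA; rewrite /eball/= -(ltr_pXn2r (ltn0Sn 1)) ?nnegrE ?enorm_ge0 ?ltW//.
rewrite sqr_enorm; apply: (@le_lt_trans _ _ (\sum_(i < n) l ^+ 2)).
  apply: ler_sum => i _; have := xab i; rewrite !mxE => /andP[? ?].
  nra.
rewrite sumr_const card_ord -mulr_natl.
have -> : n%:R * l ^+ 2 = r ^+ 2 / (4 * n%:R) by rewrite /l; field; rewrite gt_eqF.
rewrite ltr_pdivrMr ?mulr_gt0// ltr_pMr ?exprn_gt0//.
have : 1 <= n%:R :> R by rewrite ler1n.
lra.
Qed.

End ObstacleProblem.

(** * Choice of the constants and the density estimate *)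

Theorem corollary3p6 (R : realType) (n : nat) (n_gt0 : (0 < n)%N)
    (nu M S d : R) (nu_gt0 : 0 < nu) :
  exists delta : R, 0 < delta /\
    forall (f u : 'rV[R]_n -> R) (x0 : 'rV[R]_n),
      {within unit_ball R n, continuous f} ->
      (forall x, unit_ball R n x -> nu <= f x <= M) ->
      {within closure (unit_ball R n), continuous u} ->
      obstacle_solution f u ->
      sup [set u x | x in unit_ball R n] = S ->
      (bdry (positivity_set u) `&` unit_ball R n) x0 ->
      edist_to x0 (bdry (unit_ball R n)) = d ->
      forall rho : R, 0 < rho -> eball x0 rho `<=` unit_ball R n ->
        ((delta * rho ^+ n)%:E <=
          lebesgue_measure_rV (eball x0 rho `&` positivity_set u))%E.
Proof.
(* The paraboloid will have coefficient [al / t] with [t^3 = r^2], so its infinity Laplacian is at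
   most [8 al^3 <= 8 al < nu]. *)
pose al : R := Num.min 1 (nu / 9).
have al0 : 0 < al by rewrite lt_min ltr01 divr_gt0.
have al1 : al <= 1 by rewrite ge_min lexx.
have alnu : al <= nu / 9 by rewrite ge_min lexx orbT.
(* The barrier on the ball of radius [k r] has coefficient [m / t]; this [m] makes
   [(m / t)^3 (k r)^2 = m^2 al / 2] exceed [M]. *)
pose m := 1 + 2 * `|M| / al.
have m1 : 1 <= m by rewrite lerDl divr_ge0 ?mulr_ge0 ?(ltW al0).
have m0 : 0 < m by apply: lt_le_trans m1.
have mM : M < m ^+ 2 * al / 2.
  have mal : m * al = al + 2 * `|M|.
    by rewrite mulrDl mul1r -mulrA mulVf ?mulr1 ?gt_eqF.
  have := ler_norm M; have : m * al <= m ^+ 2 * al by rewrite ler_pM2r ?ler_eXnr.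
  lra.
(* Chosen so that the central height [2 (m / t) (k r)^2] of the barrier equals the nondegeneracy
   bound [(al / t) r^2]. *)
pose k := Num.sqrt (al / (2 * m)).
have k0 : 0 < k by rewrite sqrtr_gt0 divr_gt0 ?mulr_gt0.
have k2 : k ^+ 2 = al / (2 * m) by rewrite sqr_sqrtr// ltW// divr_gt0 ?mulr_gt0.
have k1 : k <= 1.
  rewrite -(ler_pXn2r (ltn0Sn 1)) ?nnegrE ?(ltW k0)// k2 expr1n ler_pdivrMr ?mulr_gt0//.
  lra.
have n0 : 0 < n%:R :> R by rewrite ltr0n.
exists ((k / (4 * n%:R)) ^+ n); split; first by rewrite exprn_gt0 ?divr_gt0 ?mulr_gt0.
move=> f u x0 _ fb ucont [u0 ule uge] _ [[x0cl _] _] _ rho rho0 rhoU.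
(* Two steps of length at most [r] lead from [x0] to [y1] and then to [y]; the ball of radius
   [k r <= r] around [y] stays inside [eball x0 rho]. *)
pose r := rho / 4.
have r0 : 0 < r by rewrite divr_gt0.
(* With [t^3 = r^2], the height [r^(4/3)] is [t^2] and the scaling identities become rational in
   [t]. *)
pose t := r `^ (2 / 3).
have t0 : 0 < t by rewrite powR_gt0.
have t3 : t ^+ 3 = r ^+ 2.
  rewrite -powR_mulrn ?(ltW t0)// -powRrM -powR_mulrn ?(ltW r0)//; congr (_ `^ _).
  by field.
have inU y' s : enorm (y' - x0) + s < 4 * r -> ecball y' s `<=` eball x0 rho.
  move=> ys z; rewrite /ecball/eball/= => zs.
  have := enorm_trans y' z x0; move: ys; rewrite /r; lra.
have cont y' s : ecball y' s `<=` eball x0 rho -> {within ecball y' s, continuous u}.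
  move=> sub; apply: continuous_subspaceW ucont => z /sub/rhoU.
  exact: subset_closure.
have x0r : \forall z \near x0, enorm (z - x0) < r.
  by apply: eball_nbhs; rewrite subrr enorm0.
(* Nondegeneracy needs a centre with [u > 0]; as [x0] lies in the closure of the positivity set,
   there is one within [r]. *)
have [y1 [[_ uy1] y1r]] := x0cl _ x0r.
have y1U : ecball y1 r `<=` eball x0 rho by apply: inU; move: y1r => /=; lra.
have fnu z : unit_ball R n z -> nu <= f z by move=> /fb /andP[].
have fM z : unit_ball R n z -> f z <= M by move=> /fb /andP[].
have tn0 : t != 0 by rewrite gt_eqF.
have mn0 : m != 0 by rewrite gt_eqF.
have anu : 8 * (al / t) ^+ 3 * r ^+ 2 < nu.
  have -> : 8 * (al / t) ^+ 3 * r ^+ 2 = 8 * al ^+ 3 by rewrite -t3; field.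
  have : al ^+ 3 <= al by rewrite ler_iXnr// (ltW al0).
  lra.
have [y yr uy] := @nondegeneracy _ _ f u y1 nu _ r (divr_gt0 al0 t0) r0 anu
  (subset_trans y1U rhoU) fnu (cont _ _ y1U) uge uy1.
have krr : k * r <= r by rewrite ler_piMl// (ltW r0).
have yU : ecball y (k * r) `<=` eball x0 rho.
  apply: inU; have := enorm_trans y1 y x0; move: y1r => /=; rewrite yr; lra.
have kr2 : (k * r) ^+ 2 = al / (2 * m) * t ^+ 3 by rewrite exprMn k2 t3.
have upos : forall z, enorm (z - y) < k * r -> 0 < u z.
  apply: (@positivity_propagation _ _ f u y M (m / t)) => //.
  - by rewrite divr_gt0.
  - by rewrite mulr_gt0.
  - rewrite kr2; suff -> : (m / t) ^+ 3 * (al / (2 * m) * t ^+ 3) = m ^+ 2 * al / 2.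
      by [].
    by field; rewrite tn0 mn0.
  - exact: subset_trans yU rhoU.
  - exact: cont.
  - rewrite kr2; apply: le_trans (ltW uy); rewrite -t3.
    by rewrite le_eqVlt; apply/orP; left; apply/eqP; field; rewrite tn0 mn0.
have -> : (k / (4 * n%:R)) ^+ n * rho ^+ n = (k * r / n%:R) ^+ n.
  by rewrite -exprMn; congr (_ ^+ _); rewrite /r; field; rewrite gt_eqF.
apply: (@eball_volume_le _ _ y) => //; first by rewrite mulr_gt0.
move=> z zy; have zU : eball x0 rho z by apply: yU; exact: ltW.
by split => //; split; [exact: rhoU | exact: upos].
Qed.
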